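(* Let $\mathscr{C}$ be a strongly representable Markov category and let $I$, $O$ be objects of $\mathscr{C}$. Let $F\colon\mathbf{UnifilarComb}(I,O)\to\mathbf{CombMachine}(I,O)$ be the forgetful functor, and let $B\colon\mathbf{CombMachine}(I,O)\to\mathbf{UnifilarComb}(I,O)$ be the functor sending $(S,\alpha)$ to $(PS,B\alpha)$ and a morphism with underlying map $f\colon S\to T$ to the morphism with underlying map $Pf\colon PS\to PT$. Then $B$ is right adjoint to $F$.
   Context: Composition is written in diagrammatic order: $f\mathbin{;}g$ means first $f$, then $g$. A Markov category is a symmetric monoidal category $(\mathscr{C},\otimes,1)$ in which every object $X$ carries a commutative comonoid structure $\operatorname{copy}_X\colon X\to X\otimes X$, $\operatorname{del}_X\colon X\to 1$, compatible with $\otimes$, with $\operatorname{del}$ natural. A morphism $f\colon A\to X$ is deterministic if $f\mathbin{;}\operatorname{copy}_X=\operatorname{copy}_A\mathbin{;}(f\otimes f)$; $\mathscr{C}_{\det}$ is the subcategory of deterministic morphisms. Coherence isomorphisms are suppressed. **Conditionals.** For $f\colon A\to X\otimes Y$ write $f_X=f\mathbin{;}(\mathrm{id}_X\otimes\operatorname{del}_Y)\colon A\to X$ and $\hat f=\operatorname{copy}_A\mathbin{;}(f_X\otimes\mathrm{id}_A)\mathbin{;}(\operatorname{copy}_X\otimes\mathrm{id}_A)\colon A\to X\otimes X\otimes A$. A morphism $c\colon X\otimes A\to Y$ is a conditional of $f$ if $f=\hat f\mathbin{;}(\mathrm{id}_X\otimes c)$. **Deterministic given $X$.** A morphism $f\colon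 A\to X\otimes Y$ that admits a conditional $c\colon X\otimes A\to Y$ is deterministic given $X$ if $$\hat f\mathbin{;}\bigl(\mathrm{id}_X\otimes(c\mathbin{;}\operatorname{copy}_Y)\bigr)=\hat f\mathbin{;}\bigl(\mathrm{id}_X\otimes(\operatorname{copy}_{X\otimes A}\mathbin{;}(c\otimes c))\bigr).$$ (This does not depend on the choice of conditional $c$.) **Representability.** A distribution object for $X$ is an object $PX$ with a morphism $\operatorname{samp}_X\colon PX\to X$ such that for every $f\colon A\to X$ there is a unique deterministic $f^{\square}\colon A\to PX$ with $f^{\square}\mathbin{;}\operatorname{samp}_X=f$. A Markov category is representable if every object has a distribution object; then $P$ extends to a functor $P\colon\mathscr{C}\to\mathscr{C}_{\det}$ with $Pf=(\operatorname{samp}_X\mathbin{;}f)^{\square}$ for $f\colon X\to Y$. A strongly representable Markov category is a representable Markov category in which for every $f\colon A\to X\otimes Y$ there is a unique $f^{\diamond}\colon A\to X\otimes PY$ that is deterministic given $X$ and satisfies $f^\diamond\mathbin{;}(\mathrm{id}_X\otimes\operatorname{samp}_Y)=f$. **Machines.** A comb machine with input space $I$ and output space $O$ is an object $S$ of $\mathscr{C}$ (the state space) with a morphism $\alpha\colon I\otimes S\to O\otimes S$ and a morphism $\alpha^\bullet\colon S\to O$ (the readout map) such that $\alpha\mathbin{;}(\mathrm{id}_O\otimes\operatorname{del}_S)=\operatorname{del}_I\otimes\alpha^\bullet$. A morphism of comb machines $(S,\alpha)\to(T,\beta)$ is a morphism $f\colon S\to T$ of $\mathscr{C}$ with $\alpha\mathbin{;}(\mathrm{id}_O\otimes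 f)=(\mathrm{id}_I\otimes f)\mathbin{;}\beta$. These form the category $\mathbf{CombMachine}(I,O)$. A unifilar comb machine is a comb machine $(S,\alpha,\alpha^\bullet)$ such that $\alpha$ is deterministic given $O$; a morphism of unifilar comb machines is a morphism of comb machines whose underlying morphism is deterministic. These form the category $\mathbf{UnifilarComb}(I,O)$. **The functors.** $F$ sends a unifilar comb machine to itself viewed as a comb machine and a morphism to its underlying (deterministic) morphism viewed as a morphism of comb machines. For a comb machine $(S,\alpha,\alpha^\bullet)$, $B\alpha=((\mathrm{id}_I\otimes\operatorname{samp}_S)\mathbin{;}\alpha)^{\diamond}\colon I\otimes PS\to O\otimes PS$, i.e. the unique morphism deterministic given $O$ with $B\alpha\mathbin{;}(\mathrm{id}_O\otimes\operatorname{samp}_S)=(\mathrm{id}_I\otimes\operatorname{samp}_S)\mathbin{;}\alpha$; the readout map of $(PS,B\alpha)$ is $\operatorname{samp}_S\mathbin{;}\alpha^\bullet$. *)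

(* Defs.v *)
From Corelib Require Import ssreflect.
From Stdlib Require Import ProofIrrelevance.

Set Implicit Arguments.
Unset Strict Implicit.
Unset Printing Implicit Defensive.

Declare Scope markov_scope.
Delimit Scope markov_scope with markov.
Open Scope markov_scope.

Reserved Notation "f ;; g" (at level 50, left associativity).
Reserved Notation "X ⊗ Y" (at level 40, left associativity).
Reserved Notation "f ⊠ g" (at level 40, left associativity).

Record Category := {
  Ob :> Type;
  hom : Ob -> Ob -> Type;
  idm : forall X, hom X X;
  comp : forall X Y Z, hom X Y -> hom Y Z -> hom X Z;
  comp_idl : forall X Y (f : hom X Y), comp (idm X) f = f;
  comp_idr : forall X Y (f : hom X Y), comp f (idm Y) = f;
  comp_assoc : forall X Y Z W (f : hom X Y) (g : hom Y Z) (h : hom Z W),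
    comp f (comp g h) = comp (comp f g) h
}.

Arguments hom {c} X Y.
Arguments idm {c} X.

(** Diagrammatic order: [f ;; g] is first [f], then [g]. *)
Notation "f ;; g" := (comp f g) : markov_scope.

Record Functor (C D : Category) := {
  fobj :> C -> D;
  fmap : forall X Y : C, hom X Y -> hom (fobj X) (fobj Y);
  fmap_id : forall X : C, fmap (idm X) = idm (fobj X);
  fmap_comp : forall (X Y Z : C) (f : hom X Y) (g : hom Y Z),
    fmap (f ;; g) = fmap f ;; fmap g
}.

(** [Adjunction L R] is the type of adjunctions with [L] left adjoint to [R]. *)
Record Adjunction (C D : Category) (L : Functor C D) (R : Functor D C) := {
  transpose : forall (X : C) (Y : D), hom (L X) Y -> hom X (R Y);
  untranspose : forall (X : C) (Y : D), hom X (R Y) -> hom (L X) Y;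
  transposeK : forall X Y (f : hom (L X) Y), untranspose (transpose f) = f;
  untransposeK : forall X Y (g : hom X (R Y)), transpose (untranspose g) = g;
  transpose_natl : forall (X X' : C) (Y : D) (u : hom X' X) (f : hom (L X) Y),
    transpose (fmap L u ;; f) = u ;; transpose f;
  transpose_natr : forall (X : C) (Y Y' : D) (f : hom (L X) Y) (v : hom Y Y'),
    transpose (f ;; v) = transpose f ;; fmap R v
}.

Record SymmetricMonoidalCategory := {
  smc_cat :> Category;
  tens : smc_cat -> smc_cat -> smc_cat;
  unit_ob : smc_cat;
  tensm : forall X X' Y Y' : smc_cat,
    hom X X' -> hom Y Y' -> hom (tens X Y) (tens X' Y');
  tensm_id : forall X Y : smc_cat, tensm (idm X) (idm Y) = idm (tens X Y);
  tensm_comp : forall (X X' X'' Y Y' Y'' : smc_cat)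
      (f : hom X X') (f' : hom X' X'') (g : hom Y Y') (g' : hom Y' Y''),
    tensm (f ;; f') (g ;; g') = tensm f g ;; tensm f' g';
  assoc : forall X Y Z : smc_cat, hom (tens (tens X Y) Z) (tens X (tens Y Z));
  assoc_inv : forall X Y Z : smc_cat, hom (tens X (tens Y Z)) (tens (tens X Y) Z);
  assocK : forall X Y Z, assoc X Y Z ;; assoc_inv X Y Z = idm _;
  assoc_invK : forall X Y Z, assoc_inv X Y Z ;; assoc X Y Z = idm _;
  assoc_nat : forall (X X' Y Y' Z Z' : smc_cat)
      (f : hom X X') (g : hom Y Y') (h : hom Z Z'),
    tensm (tensm f g) h ;; assoc X' Y' Z' = assoc X Y Z ;; tensm f (tensm g h);
  lunit : forall X : smc_cat, hom (tens unit_ob X) X;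
  lunit_inv : forall X : smc_cat, hom X (tens unit_ob X);
  lunitK : forall X, lunit X ;; lunit_inv X = idm _;
  lunit_invK : forall X, lunit_inv X ;; lunit X = idm _;
  lunit_nat : forall (X Y : smc_cat) (f : hom X Y),
    tensm (idm unit_ob) f ;; lunit Y = lunit X ;; f;
  runit : forall X : smc_cat, hom (tens X unit_ob) X;
  runit_inv : forall X : smc_cat, hom X (tens X unit_ob);
  runitK : forall X, runit X ;; runit_inv X = idm _;
  runit_invK : forall X, runit_inv X ;; runit X = idm _;
  runit_nat : forall (X Y : smc_cat) (f : hom X Y),
    tensm f (idm unit_ob) ;; runit Y = runit X ;; f;
  braid : forall X Y : smc_cat, hom (tens X Y) (tens Y X);
  braidK : forall X Y, braid X Y ;; braid Y X = idm _;
  braid_nat : forall (X X' Y Y' : smc_cat) (f : hom X X') (g : hom Y Y'),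
    tensm f g ;; braid X' Y' = braid X Y ;; tensm g f;
  pentagon : forall X Y Z W : smc_cat,
    tensm (assoc X Y Z) (idm W) ;; assoc X (tens Y Z) W ;; tensm (idm X) (assoc Y Z W)
    = assoc (tens X Y) Z W ;; assoc X Y (tens Z W);
  triangle : forall X Y : smc_cat,
    assoc X unit_ob Y ;; tensm (idm X) (lunit Y) = tensm (runit X) (idm Y);
  hexagon : forall X Y Z : smc_cat,
    assoc X Y Z ;; braid X (tens Y Z) ;; assoc Y Z X
    = tensm (braid X Y) (idm Z) ;; assoc Y X Z ;; tensm (idm Y) (braid X Z)
}.

Arguments unit_ob {s}.

Notation "X ⊗ Y" := (tens X Y) : markov_scope.
Notation "f ⊠ g" := (tensm f g) : markov_scope.

(** The coherence map exchanging the two middle factors. *)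
Definition middle_swap (C : SymmetricMonoidalCategory) (X Y Z W : C) :
    hom ((X ⊗ Y) ⊗ (Z ⊗ W)) ((X ⊗ Z) ⊗ (Y ⊗ W)) :=
  assoc X Y (Z ⊗ W)
  ;; idm X ⊠ (assoc_inv Y Z W ;; braid Y Z ⊠ idm W ;; assoc Z Y W)
  ;; assoc_inv X Z (Y ⊗ W).

Record MarkovCategory := {
  markov_smc :> SymmetricMonoidalCategory;
  copy : forall X : markov_smc, hom X (X ⊗ X);
  del : forall X : markov_smc, hom X unit_ob;
  copy_coassoc : forall X,
    copy X ;; copy X ⊠ idm X ;; assoc X X X = copy X ;; idm X ⊠ copy X;
  copy_counitl : forall X, copy X ;; del X ⊠ idm X ;; lunit X = idm X;
  copy_counitr : forall X, copy X ;; idm X ⊠ del X ;; runit X = idm X;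
  copy_comm : forall X, copy X ;; braid X X = copy X;
  copy_tens : forall X Y, copy (X ⊗ Y) = copy X ⊠ copy Y ;; middle_swap X X Y Y;
  copy_unit : copy unit_ob = lunit_inv unit_ob;
  del_tens : forall X Y, del (X ⊗ Y) = del X ⊠ del Y ;; lunit unit_ob;
  del_unit : del unit_ob = idm unit_ob;
  del_nat : forall (X Y : markov_smc) (f : hom X Y), f ;; del Y = del X
}.

Definition deterministic (C : MarkovCategory) (A X : C) (f : hom A X) : Prop :=
  f ;; copy X = copy A ;; f ⊠ f.

Definition marginal (C : MarkovCategory) (A X Y : C) (f : hom A (X ⊗ Y)) : hom A X :=
  f ;; idm X ⊠ del Y ;; runit X.

(** [X ⊗ X ⊗ A] is bracketed so that a conditional [X ⊗ A -> Y] can be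
    applied to its last two factors. *)
Definition fhat (C : MarkovCategory) (A X Y : C) (f : hom A (X ⊗ Y)) :
    hom A (X ⊗ (X ⊗ A)) :=
  copy A ;; marginal f ⊠ idm A ;; copy X ⊠ idm A ;; assoc X X A.

Definition is_conditional (C : MarkovCategory) (A X Y : C)
    (f : hom A (X ⊗ Y)) (c : hom (X ⊗ A) Y) : Prop :=
  f = fhat f ;; idm X ⊠ c.

(** The equation holds for one conditional iff it holds for all of them. *)
Definition deterministic_given (C : MarkovCategory) (A X Y : C)
    (f : hom A (X ⊗ Y)) : Prop :=
  exists c : hom (X ⊗ A) Y,
    is_conditional f c /\
    fhat f ;; idm X ⊠ (c ;; copy Y) = fhat f ;; idm X ⊠ (copy (X ⊗ A) ;; c ⊠ c).

(** A distribution object: the unique deterministic lift of [f] along [samp]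
    is given as an operation [box]. *)
Record DistributionObject (C : MarkovCategory) (X : C) := {
  dist :> C;
  samp : hom dist X;
  box : forall A : C, hom A X -> hom A dist;
  box_det : forall (A : C) (f : hom A X), deterministic (box f);
  box_samp : forall (A : C) (f : hom A X), box f ;; samp = f;
  box_unique : forall (A : C) (f : hom A X) (g : hom A dist),
    deterministic g -> g ;; samp = f -> g = box f
}.

Record RepresentableMarkovCategory := {
  rep_markov :> MarkovCategory;
  P : forall X : rep_markov, DistributionObject X
}.

Definition Pmap (C : RepresentableMarkovCategory) (X Y : C) (f : hom X Y) :
    hom (P X) (P Y) :=
  box (P Y) (samp (P X) ;; f).

Record StronglyRepresentableMarkovCategory := {
  srep_rep :> RepresentableMarkovCategory;
  diamond : forall A X Y : srep_rep, hom A (X ⊗ Y) -> hom A (X ⊗ P Y);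
  diamond_det : forall (A X Y : srep_rep) (f : hom A (X ⊗ Y)),
    deterministic_given (diamond f);
  diamond_samp : forall (A X Y : srep_rep) (f : hom A (X ⊗ Y)),
    diamond f ;; idm X ⊠ samp (P Y) = f;
  diamond_unique : forall (A X Y : srep_rep) (f : hom A (X ⊗ Y))
      (g : hom A (X ⊗ P Y)),
    deterministic_given g -> g ;; idm X ⊠ samp (P Y) = f -> g = diamond f
}.

Section Deterministic.
Variable C : MarkovCategory.
Implicit Types A B X Y Z W : C.

Lemma assoc_inv_nat X X' Y Y' Z Z' (f : hom X X') (g : hom Y Y') (h : hom Z Z') :
  f ⊠ (g ⊠ h) ;; assoc_inv X' Y' Z' = assoc_inv X Y Z ;; (f ⊠ g) ⊠ h.
Proof.
rewrite -[LHS]comp_idl -(assoc_invK X Y Z) -!comp_assoc.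
by rewrite [assoc X Y Z ;; _]comp_assoc -assoc_nat -comp_assoc assocK comp_idr.
Qed.

Lemma middle_swap_nat X X' Y Y' Z Z' W W'
    (f : hom X X') (g : hom Y Y') (h : hom Z Z') (k : hom W W') :
  (f ⊠ g) ⊠ (h ⊠ k) ;; middle_swap X' Y' Z' W'
  = middle_swap X Y Z W ;; (f ⊠ h) ⊠ (g ⊠ k).
Proof.
have inner : g ⊠ (h ⊠ k) ;; (assoc_inv Y' Z' W' ;; braid Y' Z' ⊠ idm W' ;; assoc Z' Y' W')
    = (assoc_inv Y Z W ;; braid Y Z ⊠ idm W ;; assoc Z Y W) ;; h ⊠ (g ⊠ k).
  rewrite !comp_assoc assoc_inv_nat -!comp_assoc -assoc_nat; congr (_ ;; _).
  by rewrite !comp_assoc -!tensm_comp braid_nat comp_idl comp_idr.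
rewrite /middle_swap !comp_assoc assoc_nat -!comp_assoc -assoc_inv_nat.
congr (_ ;; _); rewrite !comp_assoc; congr (_ ;; _).
move: inner; rewrite !comp_assoc => inner.
by rewrite -!tensm_comp !comp_assoc inner comp_idl comp_idr.
Qed.

Lemma det_id X : deterministic (idm X).
Proof. by rewrite /deterministic comp_idl tensm_id comp_idr. Qed.

Lemma det_comp X Y Z (f : hom X Y) (g : hom Y Z) :
  deterministic f -> deterministic g -> deterministic (f ;; g).
Proof.
rewrite /deterministic => df dg.
by rewrite -comp_assoc dg comp_assoc df -comp_assoc -tensm_comp.
Qed.

Lemma det_tens X X' Y Y' (f : hom X X') (g : hom Y Y') :
  deterministic f -> deterministic g -> deterministic (f ⊠ g).
Proof.
rewrite /deterministic => df dg.
rewrite !copy_tens comp_assoc -tensm_comp df dg tensm_comp.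
by rewrite -[LHS]comp_assoc middle_swap_nat [LHS]comp_assoc.
Qed.

Lemma marginal_post A X Y Z (f : hom A (X ⊗ Y)) (g : hom Y Z) :
  marginal (f ;; idm X ⊠ g) = marginal f.
Proof.
by rewrite /marginal -[f ;; _ ;; _]comp_assoc -tensm_comp comp_idl del_nat.
Qed.

Lemma det_given_post A X Y Z (f : hom A (X ⊗ Y)) (g : hom Y Z) :
  deterministic_given f -> deterministic g ->
  deterministic_given (f ;; idm X ⊠ g).
Proof.
move=> [c [cf dc]] dg; exists (c ;; g).
have ehat : fhat (f ;; idm X ⊠ g) = fhat f by rewrite /fhat marginal_post.
have idD (U V W : C) (u : hom U V) (v : hom V W) :
    idm X ⊠ (u ;; v) = idm X ⊠ u ;; idm X ⊠ v.
  by rewrite -tensm_comp comp_idl.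
rewrite /is_conditional ehat; split; first by rewrite {1}cf idD comp_assoc.
have e1 : c ;; g ;; copy Z = (c ;; copy Y) ;; g ⊠ g.
  by rewrite -comp_assoc dg comp_assoc.
have e2 : copy (X ⊗ A) ;; (c ;; g) ⊠ (c ;; g) = (copy (X ⊗ A) ;; c ⊠ c) ;; g ⊠ g.
  by rewrite tensm_comp comp_assoc.
by rewrite e1 e2 (idD _ _ _ (c ;; copy Y)) (idD _ _ _ (_ ;; c ⊠ c)) !comp_assoc dc.
Qed.

Lemma fhat_pre A B X Y (h : hom B A) (f : hom A (X ⊗ Y)) :
  deterministic h -> fhat (h ;; f) ;; idm X ⊠ (idm X ⊠ h) = h ;; fhat f.
Proof.
move=> dh; rewrite /fhat.
have -> : marginal (h ;; f) = h ;; marginal f by rewrite /marginal !comp_assoc.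
move: (marginal f) => m; rewrite -[LHS]comp_assoc -assoc_nat tensm_id !comp_assoc dh.
congr (_ ;; _); rewrite -!(comp_assoc (copy B)); congr (_ ;; _).
by rewrite -!tensm_comp !comp_idl !comp_idr.
Qed.

Lemma det_given_pre A B X Y (h : hom B A) (f : hom A (X ⊗ Y)) :
  deterministic h -> deterministic_given f -> deterministic_given (h ;; f).
Proof.
move=> dh [c [cf dc]]; exists (idm X ⊠ h ;; c).
have idD (U V W : C) (u : hom U V) (v : hom V W) :
    idm X ⊠ (u ;; v) = idm X ⊠ u ;; idm X ⊠ v.
  by rewrite -tensm_comp comp_idl.
split.
  by rewrite /is_conditional idD comp_assoc fhat_pre // -comp_assoc -cf.
have e : copy (X ⊗ B) ;; (idm X ⊠ h ;; c) ⊠ (idm X ⊠ h ;; c)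
    = idm X ⊠ h ;; (copy (X ⊗ A) ;; c ⊠ c).
  by rewrite [(_ ;; c) ⊠ _]tensm_comp comp_assoc -(det_tens (det_id X) dh) -comp_assoc.
rewrite e -comp_assoc !(idD _ _ _ (idm X ⊠ h)) [LHS]comp_assoc [RHS]comp_assoc.
by rewrite fhat_pre // -[LHS]comp_assoc dc comp_assoc.
Qed.

End Deterministic.

Section CombMachines.
Variables (C : MarkovCategory) (I O : C).

Record comb_machine := CombM {
  state : C;
  step : hom (I ⊗ state) (O ⊗ state);
  readout : hom state O;
  step_readout :
    step ;; idm O ⊠ del state ;; runit O = del I ⊠ readout ;; lunit O
}.

Record comb_morphism (M N : comb_machine) := CombMor {
  cm_map :> hom (state M) (state N);
  cm_comm : step M ;; idm O ⊠ cm_map = idm I ⊠ cm_map ;; step N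
}.

Lemma comb_morphism_eq M N (f g : comb_morphism M N) : cm_map f = cm_map g -> f = g.
Proof.
case: f g => f hf [g hg] /= e; rewrite e in hf *.
by rewrite (proof_irrelevance _ hf hg).
Qed.

Lemma comb_id_comm M :
  step M ;; idm O ⊠ idm (state M) = idm I ⊠ idm (state M) ;; step M.
Proof. by rewrite !tensm_id comp_idl comp_idr. Qed.

Lemma comb_comp_comm M N K (f : comb_morphism M N) (g : comb_morphism N K) :
  step M ;; idm O ⊠ (cm_map f ;; cm_map g)
  = idm I ⊠ (cm_map f ;; cm_map g) ;; step K.
Proof.
rewrite -[idm O]comp_idl -[idm I]comp_idl !tensm_comp comp_assoc cm_comm.
by rewrite -!comp_assoc cm_comm.
Qed.

Definition CombMachine : Category.
Proof.
refine {|
  Ob := comb_machine;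
  hom := comb_morphism;
  idm := fun M => CombMor (comb_id_comm M);
  comp := fun M N K f g => CombMor (comb_comp_comm f g) |}.
- by move=> M N f; apply: comb_morphism_eq; apply: comp_idl.
- by move=> M N f; apply: comb_morphism_eq; apply: comp_idr.
- by move=> M N K L f g h; apply: comb_morphism_eq; apply: comp_assoc.
Defined.

Record unifilar_machine := UnifilarM {
  um_comb :> comb_machine;
  um_det : deterministic_given (step um_comb)
}.

Record unifilar_morphism (M N : unifilar_machine) := UnifilarMor {
  um_mor :> comb_morphism M N;
  um_mor_det : deterministic (cm_map um_mor)
}.

Lemma unifilar_morphism_eq M N (f g : unifilar_morphism M N) :
  cm_map f = cm_map g -> f = g.
Proof.
case: f g => f hf [g hg] /= /comb_morphism_eq e; rewrite e in hf *.
by rewrite (proof_irrelevance _ hf hg).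
Qed.

Definition UnifilarComb : Category.
Proof.
refine {|
  Ob := unifilar_machine;
  hom := unifilar_morphism;
  idm := fun M => @UnifilarMor M M (CombMor (comb_id_comm M)) (det_id _);
  comp := fun M N K f g =>
    @UnifilarMor M K (CombMor (comb_comp_comm f g))
      (det_comp (um_mor_det f) (um_mor_det g)) |}.
- by move=> M N f; apply: unifilar_morphism_eq; apply: comp_idl.
- by move=> M N f; apply: unifilar_morphism_eq; apply: comp_idr.
- by move=> M N K L f g h; apply: unifilar_morphism_eq; apply: comp_assoc.
Defined.

Definition Forget : Functor UnifilarComb CombMachine.
Proof.
refine {|
  fobj := (fun M => um_comb M) : UnifilarComb -> CombMachine;
  fmap := fun M N (f : unifilar_morphism M N) => um_mor f |}.
- by [].
- by [].
Defined.

End CombMachines.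

Section Belief.
Variables (C : StronglyRepresentableMarkovCategory) (I O : C).

Lemma Pmap_det (X Y : C) (f : hom X Y) : deterministic (Pmap f).
Proof. exact: box_det. Qed.

Lemma Pmap_samp (X Y : C) (f : hom X Y) :
  Pmap f ;; samp (P Y) = samp (P X) ;; f.
Proof. exact: box_samp. Qed.

Lemma Pmap_id (X : C) : Pmap (idm X) = idm (P X : C).
Proof.
by symmetry; apply: box_unique; [exact: det_id | rewrite comp_idl comp_idr].
Qed.

Lemma Pmap_comp (X Y Z : C) (f : hom X Y) (g : hom Y Z) :
  Pmap (f ;; g) = Pmap f ;; Pmap g.
Proof.
symmetry; apply: box_unique; first exact: det_comp (Pmap_det _) (Pmap_det _).
by rewrite -comp_assoc Pmap_samp comp_assoc Pmap_samp comp_assoc.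
Qed.

Definition Bstep (M : comb_machine I O) :
    hom (I ⊗ P (state M)) (O ⊗ P (state M)) :=
  diamond (idm I ⊠ samp (P (state M)) ;; step M).

Lemma Bstep_readout (M : comb_machine I O) :
  Bstep M ;; idm O ⊠ del (P (state M) : C) ;; runit O
  = del I ⊠ (samp (P (state M)) ;; readout M) ;; lunit O.
Proof.
rewrite -(del_nat (samp (P (state M)))) -[idm O]comp_idl tensm_comp comp_assoc.
rewrite diamond_samp -!comp_assoc [step M ;; _]comp_assoc step_readout.
by rewrite comp_assoc -tensm_comp comp_idl.
Qed.

Definition Bobj (M : comb_machine I O) : unifilar_machine I O :=
  @UnifilarM _ _ _ (CombM (Bstep_readout M)) (diamond_det _).

Lemma Bmap_comm (M N : comb_machine I O) (f : comb_morphism M N) :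
  Bstep M ;; idm O ⊠ Pmap f = idm I ⊠ Pmap f ;; Bstep N.
Proof.
transitivity (diamond (idm I ⊠ (samp (P (state M)) ;; f) ;; step N)).
  apply: diamond_unique; first exact: det_given_post (diamond_det _) (Pmap_det _).
  rewrite -comp_assoc -tensm_comp Pmap_samp tensm_comp comp_assoc diamond_samp.
  by rewrite -comp_assoc cm_comm comp_assoc -tensm_comp comp_idl.
symmetry; apply: diamond_unique.
  exact: det_given_pre (det_tens (det_id _) (Pmap_det _)) (diamond_det _).
by rewrite -comp_assoc diamond_samp comp_assoc -tensm_comp Pmap_samp comp_idl.
Qed.

Definition Bmap (M N : comb_machine I O) (f : comb_morphism M N) :
    unifilar_morphism (Bobj M) (Bobj N) :=
  @UnifilarMor _ _ _ (Bobj M) (Bobj N)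
    (@CombMor _ _ _ (Bobj M) (Bobj N) (Pmap f) (Bmap_comm f)) (Pmap_det f).

Definition B : Functor (CombMachine I O) (UnifilarComb I O).
Proof.
refine {|
  fobj := Bobj : CombMachine I O -> UnifilarComb I O;
  fmap := Bmap |}.
- by move=> M; apply: unifilar_morphism_eq; apply: Pmap_id.
- by move=> M N K f g; apply: unifilar_morphism_eq; apply: Pmap_comp.
Defined.

End Belief.

(* Main.v *)
From Corelib Require Import ssreflect.
Require Import Defs.

Set Implicit Arguments.
Unset Strict Implicit.
Unset Printing Implicit Defensive.

(** The adjunction comes from the universal property of the distribution
    object [P T]: postcomposition with [samp] is a bijection, with inverse
    [box], between deterministic maps [S -> P T] and arbitrary maps [S -> T].
    It remains to see that this bijection matches machine morphisms on both
    sides.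

    From right to left this is because [samp] is itself a morphism of comb
    machines from [B N] to [N] (the counit), by the defining equation of the
    belief step.  From left to right, let [f] be a comb morphism from a unifilar
    machine [M] to [N].  The two maps [I ⊗ S -> O ⊗ P T] that have to agree for
    [box f] to be a morphism [M -> B N] are both deterministic given [O], since
    that property survives deterministic processing of the second output and
    deterministic preprocessing; and sampling turns them into the two sides of
    the equation saying that [f] is a morphism.  By uniqueness in strong
    representability they coincide ([box_comm]).  Unifilarity of [M] is exactly
    what makes the first of them deterministic given [O].  Naturality is the
    uniqueness of deterministic lifts. *)

Lemma box_sampK (C : RepresentableMarkovCategory) (A X : C) (g : hom A (P X)) :
  deterministic g -> box (P X) (g ;; samp (P X)) = g.
Proof. by move=> dg; symmetry; apply: box_unique. Qed.

Lemma box_pre (C : RepresentableMarkovCategory) (A A' X : C)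
    (u : hom A' A) (f : hom A X) :
  deterministic u -> box (P X) (u ;; f) = u ;; box (P X) f.
Proof.
move=> du; symmetry; apply: box_unique.
  exact: det_comp du (box_det _ _).
by rewrite -comp_assoc box_samp.
Qed.

Lemma box_post (C : RepresentableMarkovCategory) (A X Y : C)
    (f : hom A X) (v : hom X Y) :
  box (P Y) (f ;; v) = box (P X) f ;; Pmap v.
Proof.
symmetry; apply: box_unique.
  exact: det_comp (box_det _ _) (box_det _ _).
by rewrite -comp_assoc /Pmap box_samp comp_assoc box_samp.
Qed.

(** The uniqueness clause of strong representability as a cancellation
    principle: among maps deterministic given [X], sampling the second output
    is injective. *)
Lemma det_given_samp_inj (C : StronglyRepresentableMarkovCategory) (A X Y : C)
    (g h : hom A (X ⊗ P Y)) :
  deterministic_given g -> deterministic_given h ->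
  g ;; idm X ⊠ samp (P Y) = h ;; idm X ⊠ samp (P Y) -> g = h.
Proof.
by move=> dg dh e; rewrite (diamond_unique dg e) -(diamond_unique dh eq_refl).
Qed.

Section BeliefAdjunction.
Variables (C : StronglyRepresentableMarkovCategory) (I O : C).

(** The belief step is a [diamond], so sampling the new belief is the same as
    sampling the old belief and then running the machine: this makes [samp] the
    counit of the adjunction. *)
Definition samp_mor (N : comb_machine I O) : comb_morphism (Bobj N) N :=
  @CombMor _ _ _ (Bobj N) N (samp (P (state N))) (diamond_samp _).

Lemma box_comm (M : unifilar_machine I O) (N : comb_machine I O)
    (f : comb_morphism M N) :
  step M ;; idm O ⊠ box (P (state N)) f
  = idm I ⊠ box (P (state N)) f ;; Bstep N.
Proof.
apply: det_given_samp_inj.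
- exact: det_given_post (um_det M) (box_det _ _).
- exact: det_given_pre (det_tens (det_id _) (box_det _ _)) (diamond_det _).
- rewrite -!comp_assoc diamond_samp [RHS]comp_assoc -!tensm_comp box_samp.
  by rewrite !comp_idl cm_comm.
Qed.

Definition box_mor (M : unifilar_machine I O) (N : comb_machine I O)
    (f : comb_morphism M N) : unifilar_morphism M (Bobj N) :=
  @UnifilarMor _ _ _ M (Bobj N)
    (@CombMor _ _ _ M (Bobj N) (box (P (state N)) f) (box_comm f))
    (box_det _ _).

Definition belief_adjunction : Adjunction (Forget I O) (B I O).
Proof.
refine (@Build_Adjunction _ _ (Forget I O) (B I O)
  (fun (M : UnifilarComb I O) (N : CombMachine I O) f => box_mor f)
  (fun (M : UnifilarComb I O) (N : CombMachine I O) g =>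
     @comp (CombMachine I O) _ _ _ (um_mor g) (samp_mor N)) _ _ _ _).
- by move=> M N f; apply: comb_morphism_eq; apply: box_samp.
- move=> M N g; apply: unifilar_morphism_eq.
  exact: box_sampK (um_mor_det g).
- move=> M M' N u f; apply: unifilar_morphism_eq.
  exact: box_pre (um_mor_det u).
- by move=> M N N' f v; apply: unifilar_morphism_eq; apply: box_post.
Defined.

End BeliefAdjunction.

Theorem theorem2p7 (C : StronglyRepresentableMarkovCategory) (I O : C) :
  inhabited (Adjunction (Forget I O) (B I O)).
Proof. exact (inhabits (belief_adjunction I O)). Qed.
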